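(* Let $1 \leq p < \infty$ and let $E$ and $F$ be Banach lattices. The following are equivalent for a positive operator $T \colon E \to F$: (a) $T^{*} \colon F^{*}\rightarrow E^{*}$ is disjoint $p$-convergent. (b) $y_{n}^{*}(T(x_{n}))\longrightarrow 0$ for every disjoint weakly $p$-summable sequence $(y_{n}^{*})_n$ in $F^{*}$ and every bounded sequence $(x_{n})_n$ in $E$. (c) $y_{n}^{*}(T(x_{n}))\longrightarrow 0$ for every disjoint weakly $p$-summable sequence $(y_{n}^{*})_n$ in $F^{*}$ and every bounded disjoint sequence $(x_{n})_n$ in $E$. (d) $y_{n}^{*}(T(x_{n}))\longrightarrow 0$ for every positive disjoint weakly $p$-summable sequence $(y_{n}^{*})_n$ in $F^{*}$ and every bounded disjoint sequence $(x_{n})_n$ in $E$. (e) $y_{n}^{*}(T(x_{n}))\longrightarrow 0$ for every positive disjoint weakly $p$-summable sequence $(y_{n}^{*})_n$ in $F^{*}$ and every bounded positive disjoint sequence $(x_{n})_n$ in $E$. (f) For every Banach lattice $G$ and every Riesz homomorphism $S \colon G\rightarrow E$, $S^{*}T^{*} \colon F^{*}\rightarrow G^{*}$ is a disjoint $p$-convergent operator. (g) For every Riesz homomorphism $S \colon \ell_{1}\rightarrow E$, $S^{*}T^{*} \colon F^{*}\rightarrow \ell_{1}^{*}$ is a disjoint $p$-convergent operator. (h) For every Banach lattice $G$ and every positive operator $S \colon G\rightarrow E$, $S^{*}T^{*} \colon F^{*}\rightarrow G^{*}$ is a disjoint $p$-convergent operator. (i) For every positive operator $S \colon \ell_{1}\rightarrow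 E$, $S^{*}T^{*} \colon F^{*}\rightarrow \ell_{1}^{*}$ is a disjoint $p$-convergent operator.
   Context: All operators are linear and bounded; $T^*$ denotes the adjoint of $T$. A sequence $(x_n)_n$ in a Banach lattice is disjoint if $|x_n|\wedge|x_m|=0$ for $n\neq m$. A sequence $(x_n)_n$ in a Banach space $Z$ is weakly $p$-summable if $(x^*(x_n))_n \in \ell_p$ for every $x^* \in Z^*$. A linear operator from a Banach lattice to a Banach space is disjoint $p$-convergent if it sends disjoint weakly $p$-summable sequences to norm null sequences. Bounded sequence means norm bounded. *)

(* Defs.v *)
From HB Require Import structures.
From mathcomp Require Import all_boot all_order all_algebra.
From mathcomp Require Import all_classical all_reals topology normedtype.
From mathcomp Require Import sequences exp.
Set Implicit Arguments.
Unset Strict Implicit.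
Unset Printing Implicit Defensive.
Import Order.TTheory GRing.Theory Num.Theory numFieldNormedType.Exports.
Local Open Scope classical_set_scope.
Local Open Scope ring_scope.

Section BoundedOperators.
Context {R : realType}.
Implicit Types V W : normedModType R.

Definition bounded_linear V W : {pred V -> W} :=
  [pred f | `[< linear f /\ continuous f >]].

Arguments bounded_linear : clear implicits.
Record bounded_op V W :=
  Bop { bop_fun :> V -> W; _ : bop_fun \in bounded_linear V W }.

HB.instance Definition _ V W := [isSub for @bop_fun V W].
HB.instance Definition _ V W := [Choice of bounded_op V W by <:].

Fact bounded_linear_submod V W : submod_closed (bounded_linear V W).
Proof.
split=> [|a f g /asboolP[fl fc] /asboolP[gl gc]]; apply/asboolP; split.
- by move=> a x y; rewrite -[RHS]/(a *: (0 : W) + (0 : W)) scaler0 addr0.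
- by move=> x; exact: cvg_cst.
- move=> b x y.
  rewrite -[LHS]/(a *: f (b *: x + y) + g (b *: x + y)).
  rewrite -[RHS]/(b *: (a *: f x + g x) + (a *: f y + g y)) fl gl.
  by rewrite !scalerDr !scalerA [a * b]mulrC addrACA.
- move=> x; apply: cvgD; last exact: gc.
  by apply: cvgZr; exact: fc.
Qed.
HB.instance Definition _ V W :=
  GRing.isSubmodClosed.Build R (V -> W) (bounded_linear V W)
    (@bounded_linear_submod V W).
HB.instance Definition _ V W :=
  [SubChoice_isSubLmodule of bounded_op V W by <:].

Lemma bop_linear V W (f : bounded_op V W) : linear f.
Proof. by have /asboolP[] := valP f. Qed.
HB.instance Definition _ V W (f : bounded_op V W) :=
  GRing.isLinear.Build R V W *:%R f (bop_linear f).

Lemma bop_continuous V W (f : bounded_op V W) : continuous f.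
Proof. by have /asboolP[] := valP f. Qed.

Definition bop_norm V W (f : bounded_op V W) : R :=
  sup [set `|f x| | x in [set x : V | `|x| <= 1]].

Lemma bop_bounded V W (f : bounded_op V W) :
  exists2 C, 0 <= C & forall x, `|f x| <= C * `|x|.
Proof.
have /linear_bounded_continuous/linear_boundedP := @bop_continuous _ _ f.
by move=> /pinfty_ex_gt0[C C0 fC]; exists C => //; exact: ltW.
Qed.

Lemma has_sup_bop V W (f : bounded_op V W) :
  has_sup [set `|f x| | x in [set x : V | `|x| <= 1]].
Proof.
split; first by exists `|f 0|, 0 => //=; rewrite normr0.
have [C C0 fC] := bop_bounded f; exists C => _ [x /= x1 <-].
by rewrite (le_trans (fC x))// ler_piMr.
Qed.

Lemma bop_norm_ge0 V W (f : bounded_op V W) : 0 <= bop_norm f.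
Proof.
apply: (le_trans (normr_ge0 (f 0))); apply: sup_upper_bound.
  exact: has_sup_bop.
by exists 0 => //=; rewrite normr0.
Qed.

Lemma bop_normP V W (f : bounded_op V W) x : `|f x| <= bop_norm f * `|x|.
Proof.
have [->|x0] := eqVneq x 0; first by rewrite linear0 !normr0 mulr0.
have nx0 : 0 < `|x| by rewrite normr_gt0.
rewrite -ler_pdivrMr//.
have -> : `|f x| / `|x| = `|f (`|x|^-1 *: x)|.
  by rewrite linearZ/= normrZ ger0_norm ?invr_ge0// mulrC.
apply: sup_upper_bound; first exact: has_sup_bop.
by exists (`|x|^-1 *: x) => //=; rewrite normfZV.
Qed.

Lemma bop_norm_le V W (f : bounded_op V W) C :
  0 <= C -> (forall x, `|f x| <= C * `|x|) -> bop_norm f <= C.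
Proof.
move=> C0 fC; apply: ge_sup.
  by exists `|f 0|, 0 => //=; rewrite normr0.
by move=> _ [x /= x1 <-]; rewrite (le_trans (fC x))// ler_piMr.
Qed.

Fact bop_normD V W (f g : bounded_op V W) :
  bop_norm (f + g) <= bop_norm f + bop_norm g.
Proof.
apply: bop_norm_le => [|x]; first by rewrite addr_ge0 ?bop_norm_ge0.
by rewrite mulrDl (le_trans (ler_normD _ _))// lerD ?bop_normP.
Qed.

Fact bop_normZ V W (a : R) (f : bounded_op V W) :
  bop_norm (a *: f) = `|a| * bop_norm f.
Proof.
have H b (g : bounded_op V W) : bop_norm (b *: g) <= `|b| * bop_norm g.
  apply: bop_norm_le => [|x]; first by rewrite mulr_ge0 ?bop_norm_ge0.
  by rewrite normrZ -mulrA ler_wpM2l ?bop_normP.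
apply/eqP; rewrite eq_le H/=.
have [->|a0] := eqVneq a 0; first by rewrite normr0 mul0r bop_norm_ge0.
rewrite -ler_pdivlMl ?normr_gt0//.
by rewrite -[in leLHS](scalerK a0 f) -normfV H.
Qed.

Fact bop_norm0_eq0 V W (f : bounded_op V W) : bop_norm f = 0 -> f = 0.
Proof.
move=> f0; apply/val_inj/funext => x /=; apply/eqP.
by rewrite -normr_le0 (le_trans (bop_normP f x))// f0 mul0r.
Qed.

HB.instance Definition _ V W := Lmodule_isNormed.Build R (bounded_op V W)
  (@bop_normD V W) (@bop_normZ V W) (@bop_norm0_eq0 V W).

End BoundedOperators.
Arguments bounded_linear {R} V W.


Lemma bounded_linearP (R : realType) (V W : normedModType R) (l : V -> W) :
  linear l -> (exists C, forall x, `|l x| <= C * `|x|) ->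
  l \in bounded_linear V W.
Proof.
move=> ll [C lC]; apply/asboolP; split => //.
pose L : {linear V -> W} := HB.pack l (GRing.isLinear.Build _ _ _ _ l ll).
have : bounded_near L (nbhs 0); last by move/linear_bounded_continuous.
apply/linear_boundedP; exists C; split; first exact: num_real.
by move=> r /ltW Cr x; rewrite (le_trans (lC x))// ler_wpM2r.
Qed.

Section BopComplete.
Context {R : realType} (V : normedModType R) (W : completeNormedModType R).

Fact bop_complete (F : set_system (bounded_op V W)) :
  ProperFilter F -> cauchy F -> cvg F.
Proof.
move=> FF /cauchyP F_cauchy.
have Fe (e : R) : 0 < e -> exists g : bounded_op V W,
    F [set f : bounded_op V W | forall x, `|g x - f x| <= e * `|x|].
  move=> e0; have [g Fg] := F_cauchy _ e0; exists g.
  apply: filterS Fg => f; rewrite -ball_normE/= => /ltW gfe x.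
  by rewrite (le_trans (bop_normP (g - f) x))// ler_wpM2r.
have Fx x : cvg ((fun f : bounded_op V W => f x) @ F).
  apply: cauchy_cvg; apply: cauchy_exP => e e0.
  have n0 : 0 < `|x| + 1 by rewrite ltr_wpDl.
  have [g Fg] := Fe (e / (`|x| + 1)) (divr_gt0 e0 n0).
  exists (g x); rewrite nbhs_simpl/=; apply: filterS Fg => f /(_ x) gfx.
  rewrite -ball_normE/=; apply: le_lt_trans gfx _.
  by rewrite mulrAC ltr_pdivrMr// ltr_pM2l// ltrDl.
pose l x := lim ((fun f : bounded_op V W => f x) @ F).
have Fl (e : R) : 0 < e ->
    F [set f : bounded_op V W | forall x, `|l x - f x| <= e * `|x|].
  move=> e0; have [g Fg] := Fe (e / 2) (divr_gt0 e0 (ltr0Sn _ 1)).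
  apply: filterS (Fg) => f gf x; apply/ler_addgt0Pr => d d0.
  have /cvgrPdist_lt/(_ d d0) lx := Fx x.
  have [h [/= lhx gh]] := filter_ex (filterI lx Fg).
  rewrite (le_trans (ler_distD (h x) _ _))// [leRHS]addrC lerD//.
     exact: ltW.
  rewrite (le_trans (ler_distD (g x) _ _))// [e]splitr mulrDl lerD//.
  by rewrite distrC.
have ll : linear l.
  move=> a x y; apply: cvg_lim => //.
  under eq_fun do rewrite linearP.
  by apply: cvgD; [apply: cvgZr|]; exact: Fx.
have lb : exists C, forall x, `|l x| <= C * `|x|.
  have [f lf] := filter_ex (Fl 1 ltr01).
  exists (1 + bop_norm f) => x; rewrite -(subrK (f x) (l x)).
  by rewrite (le_trans (ler_normD _ _))// mulrDl lerD// bop_normP.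
apply/cvg_ex; exists (Bop (bounded_linearP ll lb)).
apply/cvgrPdist_le => e e0; apply: filterS (Fl e e0) => f lf.
by apply: bop_norm_le => [|x]; [exact: ltW|exact: lf].
Qed.

HB.instance Definition _ :=
  Uniform_isComplete.Build (bounded_op V W) bop_complete.

End BopComplete.

Section Ell1.
Context {R : realType}.
Implicit Types u v : nat -> R.

Definition summable1 : {pred nat -> R} :=
  [pred u : nat -> R | `[< cvgn (series (fun n => `|u n|)) >]].

Lemma summable1P u :
  reflect (exists C, forall n, series (fun n => `|u n|) n <= C)
    ((u : nat -> R) \in summable1).
Proof.
have nd : nondecreasing_seq (series (fun n => `|u n|)).
  by apply/nondecreasing_seqP => n; rewrite seriesEnat/= big_nat_recr//= lerDl.
apply: (iffP (asboolP _)) => [cu|[C uC]].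
  exists (limn (series (fun n => `|u n|))) => n.
  exact: nondecreasing_cvgn_le.
apply: nondecreasing_is_cvgn => //; exists C => _ [n _ <-]; exact: uC.
Qed.

Fact summable1_submod : submod_closed summable1.
Proof.
split=> [|a u v /summable1P[C uC] /summable1P[D vD]]; apply/summable1P.
  by exists 0 => n; rewrite seriesEnat/= big1// => i _; rewrite normr0.
exists (`|a| * C + D) => n; apply: (@le_trans _ _
    (`|a| * series (fun n => `|u n|) n + series (fun n => `|v n|) n)).
  rewrite !seriesEnat/= mulr_sumr -big_split/=; apply: ler_sum => i _.
  by rewrite (le_trans (ler_normD _ _))// normrM.
by rewrite lerD// ler_wpM2l.
Qed.

Record ell1 := Ell1 { ell1_fun :> nat -> R; _ : ell1_fun \in summable1 }.

HB.instance Definition _ := [isSub for ell1_fun].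
HB.instance Definition _ := [Choice of ell1 by <:].
HB.instance Definition _ :=
  GRing.isSubmodClosed.Build R (nat -> R) summable1 summable1_submod.
HB.instance Definition _ := [SubChoice_isSubLmodule of ell1 by <:].

Implicit Types x y z : ell1.

Definition ell1_norm x : R := limn (series (fun n => `|x n|)).

Lemma ell1_series_le x n : series (fun n => `|x n|) n <= ell1_norm x.
Proof.
apply: nondecreasing_cvgn_le; last by have /asboolP := valP x.
by apply/nondecreasing_seqP => k; rewrite seriesEnat/= big_nat_recr//= lerDl.
Qed.

Lemma ell1_norm_le x C :
  (forall n, series (fun n => `|x n|) n <= C) -> ell1_norm x <= C.
Proof.
by move=> xC; apply: limr_le; [have /asboolP := valP x|exact: nearW].
Qed.

Lemma ell1_norm_ge0 x : 0 <= ell1_norm x.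
Proof. by rewrite (le_trans _ (ell1_series_le x 0))// seriesEnat/= big_geq. Qed.

Lemma ell1_coord_le x n : `|x n| <= ell1_norm x.
Proof.
rewrite (le_trans _ (ell1_series_le x n.+1))// seriesEnat/=.
rewrite big_nat_recr//= lerDr.
by rewrite sumr_ge0.
Qed.

Fact ell1_normD x y : ell1_norm (x + y) <= ell1_norm x + ell1_norm y.
Proof.
apply: ell1_norm_le => n.
rewrite (le_trans _ (lerD (ell1_series_le x n) (ell1_series_le y n)))//.
by rewrite !seriesEnat/= -big_split/=; apply: ler_sum => i _; exact: ler_normD.
Qed.

Fact ell1_normZ (a : R) x : ell1_norm (a *: x) = `|a| * ell1_norm x.
Proof.
have H b y : ell1_norm (b *: y) <= `|b| * ell1_norm y.
  apply: ell1_norm_le => n.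
  rewrite (le_trans _ (ler_wpM2l (normr_ge0 b) (ell1_series_le y n)))//.
  by rewrite !seriesEnat/= mulr_sumr; apply: ler_sum => i _; rewrite normrM.
apply/eqP; rewrite eq_le H/=.
have [->|a0] := eqVneq a 0; first by rewrite normr0 mul0r ell1_norm_ge0.
rewrite -ler_pdivlMl ?normr_gt0//.
by rewrite -[in leLHS](scalerK a0 x) -normfV H.
Qed.

Fact ell1_norm0_eq0 x : ell1_norm x = 0 -> x = 0.
Proof.
move=> x0; apply/val_inj/funext => n /=; apply/eqP.
by rewrite -normr_le0 (le_trans (ell1_coord_le x n))// x0.
Qed.

HB.instance Definition _ := Lmodule_isNormed.Build R ell1
  ell1_normD ell1_normZ ell1_norm0_eq0.

Fact ell1_complete (F : set_system ell1) : ProperFilter F -> cauchy F -> cvg F.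
Proof.
move=> FF /cauchyP F_cauchy.
have Fe (e : R) : 0 < e -> exists y : ell1,
    F [set x : ell1 | ell1_norm (y - x) <= e].
  move=> e0; have [g Fg] := F_cauchy _ e0; exists g.
  by apply: filterS Fg => f; rewrite -ball_normE/= => /ltW.
have Fx n : cvg ((fun x : ell1 => x n) @ F).
  apply: cauchy_cvg; apply: cauchy_exP => e e0.
  have [y Fy] := Fe (e / 2) (divr_gt0 e0 (ltr0Sn _ 1)).
  exists (y n); rewrite nbhs_simpl/=; apply: filterS Fy => x /= yx.
  rewrite -ball_normE/=; apply: le_lt_trans (ell1_coord_le (y - x) n) _.
  by apply: le_lt_trans yx _; rewrite ltr_pdivrMr// ltr_pMr// ltr1n.
pose l n := lim ((fun x : ell1 => x n) @ F).
have Fl (e : R) : 0 < e ->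
    F [set x : ell1 | forall n, series (fun n => `|l n - x n|) n <= e].
  move=> e0; have [y Fy] := Fe (e / 2) (divr_gt0 e0 (ltr0Sn _ 1)).
  apply: filterS (Fy) => x /= yx n; apply/ler_addgt0Pr => d d0.
  have Fs : (fun z : ell1 => series (fun n => `|l n - z n|) n) @ F --> (0 : R).
    rewrite [X in _ --> X](_ : _ = \sum_(0 <= i < n) `|l i - l i|); last first.
      by rewrite big1// => i _; rewrite subrr normr0.
    under eq_fun do rewrite seriesEnat/=.
    apply: (@cvg_big _ _ +%R) => [|i _]; first exact: add_continuous.
    by apply: cvg_norm; apply: cvgB; [exact: cvg_cst|exact: Fx].
  have /cvgrPdist_lt/(_ d d0) ls := Fs.
  have [z [/= lz yz]] := filter_ex (filterI ls Fy).
  have {}lz : series (fun n => `|l n - z n|) n <= d.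
    by rewrite (le_trans _ (ltW lz))// sub0r normrN ler_norm.
  apply: (@le_trans _ _ (series (fun n => `|l n - z n|) n +
     (series (fun n => `|(y - z) n|) n + series (fun n => `|(y - x) n|) n))).
    rewrite !seriesEnat/= -!big_split/=; apply: ler_sum => i _.
    rewrite (le_trans (ler_distD (z i) _ _))// lerD2l.
    by rewrite (le_trans (ler_distD (y i) _ _))// lerD2r distrC.
  rewrite [leRHS]addrC lerD// [e]splitr lerD//.
    exact: le_trans (ell1_series_le _ _) yz.
  exact: le_trans (ell1_series_le _ _) yx.
have ls : l \in summable1.
  have [x lx] := filter_ex (Fl 1 ltr01); apply/summable1P.
  exists (1 + ell1_norm x) => n.
  apply: le_trans (lerD (lx n) (ell1_series_le x n)).
  rewrite !seriesEnat/= -big_split/=; apply: ler_sum => i _.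
  by rewrite -[in leLHS](subrK (x i) (l i)) ler_normD.
apply/cvg_ex; exists (Ell1 ls); apply/cvgrPdist_le => e e0.
by apply: filterS (Fl e e0) => x lx; exact: ell1_norm_le.
Qed.

HB.instance Definition _ := Uniform_isComplete.Build ell1 ell1_complete.

End Ell1.
Arguments ell1 : clear implicits.
(* The order is part of the mixin, and not inherited from Order.Lattice,
   because HB cannot add a join of normed modules and lattices below the
   existing numeric structures; the lattice structure is recovered right after
   the definition, with the order of `ring_scope`.  In a Banach lattice E the
   notation `|x| is the norm of x; its modulus is `blatt_abs x` below. *)
HB.mixin Record isBanachLattice (R : realType) E & CompleteNormedModule R E := {
  blatt_le : rel E;
  blatt_join : E -> E -> E;
  blatt_meet : E -> E -> E;
  blatt_le_refl : reflexive blatt_le;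
  blatt_le_anti : antisymmetric blatt_le;
  blatt_le_trans : transitive blatt_le;
  blatt_leUx : forall x y z,
    blatt_le (blatt_join x y) z = blatt_le x z && blatt_le y z;
  blatt_lexI : forall x y z,
    blatt_le x (blatt_meet y z) = blatt_le x y && blatt_le x z;
  blatt_leD2r : forall z x y : E, blatt_le x y -> blatt_le (x + z) (y + z);
  blatt_scale_ge0 : forall (a : R) (x : E),
    0 <= a -> blatt_le 0 x -> blatt_le 0 (a *: x);
  blatt_ler_norm : forall x y : E,
    blatt_le (blatt_join x (- x)) (blatt_join y (- y)) -> `|x| <= `|y|
}.

#[short(type="banachLatticeType")]
HB.structure Definition BanachLattice (R : realType) :=
  {E of isBanachLattice R E & CompleteNormedModule R E}.

HB.instance Definition _ (R : realType) (E : banachLatticeType R) :=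
  @Order.Le_isPOrder.Build ring_display E (@blatt_le R E)
   blatt_le_refl blatt_le_anti blatt_le_trans.
HB.instance Definition _ (R : realType) (E : banachLatticeType R) :=
  @Order.POrder_MeetJoin_isLattice.Build ring_display E
   (@blatt_meet R E) (@blatt_join R E) (@blatt_lexI R E) (@blatt_leUx R E).


Section BanachLatticeTheory.
Context {R : realType} {E : banachLatticeType R}.
Implicit Types x y z : E.

Lemma blerD2r z x y : (x + z <= y + z) = (x <= y).
Proof.
apply/idP/idP => [|xy]; last exact: blatt_leD2r.
by move/(@blatt_leD2r _ _ (- z)); rewrite !addrK.
Qed.

Lemma blerD x y z t : x <= y -> z <= t -> x + z <= y + t.
Proof.
by move=> xy zt; apply: (@le_trans _ _ (y + z)); rewrite 1?blerD2r// 1?addrC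
  [leRHS]addrC blerD2r.
Qed.

Lemma bsubr_ge0 x y : (0 <= y - x) = (x <= y).
Proof. by rewrite -[LHS](blerD2r x) add0r subrK. Qed.

Lemma blerN2 x y : (- x <= - y) = (y <= x).
Proof. by rewrite -[LHS]bsubr_ge0 opprK addrC bsubr_ge0. Qed.

Lemma blerBlDr x y z : (x - y <= z) = (x <= z + y).
Proof. by rewrite -[LHS](blerD2r y) subrK. Qed.

Lemma blerBrDr x y z : (x <= z - y) = (x + y <= z).
Proof. by rewrite -[LHS](blerD2r y) subrK. Qed.

Definition blatt_abs x := (x `|` - x)%O.
Definition bpos x := (x `|` 0)%O.
Definition bneg x := (- x `|` 0)%O.

Lemma blatt_abs_ge0 x : 0 <= blatt_abs x.
Proof.
have : 0 <= blatt_abs x + blatt_abs x.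
  by rewrite -(subrr x) blerD// ?leUl// leUr.
move=> /(@blatt_scale_ge0 R E (2^-1)); rewrite invr_ge0 ler0n => /(_ isT).
by rewrite scalerDr -scalerDl -[2^-1]div1r -splitr scale1r.
Qed.

Lemma bpos_ge0 x : 0 <= bpos x. Proof. exact: leUr. Qed.
Lemma bneg_ge0 x : 0 <= bneg x. Proof. exact: leUr. Qed.

Lemma bposBneg x : x = bpos x - bneg x.
Proof.
apply/esym/le_anti; rewrite blerBlDr blerBrDr leUx.
rewrite -{1}[x]addr0 [x + 0]addrC [x + bneg x]addrC blerD2r bneg_ge0/=.
rewrite -blerBlDr sub0r leUl/= -blerBrDr leUx.
by rewrite -{1}[- x]add0r blerD2r bpos_ge0 bsubr_ge0 leUl.
Qed.

Lemma bposDneg_le x : bpos x + bneg x <= blatt_abs x.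
Proof.
have xa : x <= blatt_abs x by exact: leUl.
have Nxa : - x <= blatt_abs x by exact: leUr.
have na : bneg x <= blatt_abs x by rewrite leUx Nxa blatt_abs_ge0.
rewrite -blerBrDr leUx bsubr_ge0 na andbT blerBrDr addrC -blerBrDr.
by rewrite leUx bsubr_ge0 xa andbT -{1}[- x]add0r blerD2r blatt_abs_ge0.
Qed.

Lemma blatt_abs_le_norm x y : blatt_abs x <= blatt_abs y -> `|x| <= `|y|.
Proof. exact: blatt_ler_norm. Qed.

Lemma bler_scale (a : R) x : 0 <= a -> 0 <= x -> 0 <= a *: x.
Proof. exact: blatt_scale_ge0. Qed.

Lemma bler_norm x y : x <= y -> - x <= y -> `|x| <= `|y|.
Proof.
move=> xy Nxy; apply: blatt_abs_le_norm.
by rewrite leUx !(le_trans _ (leUl y (- y))).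
Qed.

Lemma norm_bpos x : `|bpos x| <= `|x|.
Proof.
apply: blatt_abs_le_norm; rewrite leUx leUx leUl blatt_abs_ge0/=.
by rewrite (le_trans _ (blatt_abs_ge0 x))// -[0]oppr0 blerN2 bpos_ge0.
Qed.

Lemma norm_bneg x : `|bneg x| <= `|x|.
Proof. by rewrite -[leRHS]normrN; exact: (norm_bpos (- x)). Qed.

Lemma norm_bposDneg x : `|bpos x + bneg x| <= `|x|.
Proof.
have p0 : 0 <= bpos x + bneg x by rewrite -[0]addr0 blerD ?bpos_ge0 ?bneg_ge0.
apply: blatt_abs_le_norm; rewrite leUx bposDneg_le/=.
by rewrite (le_trans _ (blatt_abs_ge0 x))// -[0]oppr0 blerN2.
Qed.

Lemma riesz_decomposition x y z : 0 <= x -> 0 <= y -> 0 <= z -> z <= x + y ->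
  exists a b, [/\ z = a + b, 0 <= a <= x & 0 <= b <= y].
Proof.
move=> x0 y0 z0 zxy; exists (z `&` x)%O, (z - (z `&` x)%O).
rewrite [RHS]addrC subrK lexI z0 x0 leIr bsubr_ge0 leIl/=; split=> //.
rewrite blerBlDr [leRHS]addrC -blerBlDr lexI !blerBlDr zxy andbT.
by rewrite -{1}[z]add0r [leRHS]addrC blerD2r.
Qed.

End BanachLatticeTheory.

Section DualLattice.
Context {R : realType} {E : banachLatticeType R}.
Local Notation dual := (bounded_op E R).
Implicit Types (f g h : dual) (x y z : E).

Definition dual_le f g := `[< forall x, 0 <= x -> f x <= g x >].

Fact dual_le_refl : reflexive dual_le.
Proof. by move=> f; apply/asboolP. Qed.

Fact dual_le_anti : antisymmetric dual_le.
Proof.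
move=> f g /andP[/asboolP fg /asboolP gf]; apply/val_inj/funext => x /=.
rewrite (bposBneg x) !linearB/=.
by congr (_ - _); apply: le_anti; rewrite fg ?gf ?bpos_ge0 ?bneg_ge0.
Qed.

Fact dual_le_trans : transitive dual_le.
Proof.
move=> g f h /asboolP fg /asboolP gh; apply/asboolP => x x0.
exact: le_trans (fg x x0) (gh x x0).
Qed.

(* The supremum of f and g is given by the Riesz-Kantorovich formula
   (f `|` g) x = sup {f y + g (x - y) | 0 <= y <= x} for x >= 0, extended to
   all x by x = bpos x - bneg x. *)
Definition dual_join_set f g x : set R :=
  [set f y + g (x - y) | y in [set y | 0 <= y <= x]].

Definition dual_join_fun f g x : R :=
  sup (dual_join_set f g (bpos x)) - sup (dual_join_set f g (bneg x)).

Lemma dual_join_set_le f g x c : 0 <= x -> dual_join_set f g x c ->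
  `|c| <= (`|f| + `|g|) * `|x|.
Proof.
move=> x0 [y /= /andP[y0 yx] <-].
rewrite (le_trans (ler_normD _ _))// mulrDl lerD//.
  rewrite (le_trans (bop_normP _ _))// ler_wpM2l ?bop_norm_ge0// bler_norm//.
  by rewrite (le_trans _ x0)// -[0]oppr0 blerN2.
rewrite (le_trans (bop_normP _ _))// ler_wpM2l ?bop_norm_ge0// bler_norm//.
  by rewrite blerBlDr -{1}[x]addr0 ![x + _]addrC blerD2r.
by rewrite opprB blerBlDr (le_trans yx)// -{1}[x]addr0 ![x + _]addrC blerD2r.
Qed.

Lemma has_sup_dual_join f g x : 0 <= x -> has_sup (dual_join_set f g x).
Proof.
move=> x0; split; first by exists (f 0 + g (x - 0)), 0 => //=; rewrite lexx x0.
exists ((`|f| + `|g|) * `|x|) => c /(dual_join_set_le x0).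
exact: le_trans (ler_norm _).
Qed.

Lemma dual_join_setD f g x y : 0 <= x -> 0 <= y ->
  dual_join_set f g (x + y) =
  [set c + d | c in dual_join_set f g x & d in dual_join_set f g y].
Proof.
move=> x0 y0; apply/seteqP; split => [_ [z /= /andP[z0 zxy] <-]|].
  have [a [b [-> /andP[a0 ax] /andP[b0 yb]]]] :=
    riesz_decomposition x0 y0 z0 zxy.
  exists (f a + g (x - a)); first by exists a => //=; rewrite a0.
  exists (f b + g (y - b)); first by exists b => //=; rewrite b0.
  by rewrite addrACA -!linearD/= opprD addrACA.
move=> _ [_ [a /= /andP[a0 ax] <-] [_ [b /= /andP[b0 yb] <-] <-]].
exists (a + b); first by rewrite /= blerD// -[0]addr0 blerD.
by rewrite addrACA -!linearD/= opprD addrACA.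
Qed.

Lemma sup_dual_joinD f g x y : 0 <= x -> 0 <= y ->
  sup (dual_join_set f g (x + y)) =
  sup (dual_join_set f g x) + sup (dual_join_set f g y).
Proof.
by move=> x0 y0; rewrite dual_join_setD// sup_sumE//; exact: has_sup_dual_join.
Qed.

Lemma sup_dual_joinZ f g a x : 0 <= a -> 0 <= x ->
  sup (dual_join_set f g (a *: x)) = a * sup (dual_join_set f g x).
Proof.
have H b y : 0 < b -> 0 <= y ->
    sup (dual_join_set f g (b *: y)) <= b * sup (dual_join_set f g y).
  move=> b0 y0; apply: ge_sup.
    by have [] := has_sup_dual_join f g (bler_scale (ltW b0) y0).
  move=> _ [z /= /andP[z0 zy] <-].
  rewrite -ler_pdivrMl// mulrDr.
  rewrite -[b^-1 * f z]/(b^-1 *: f z) -[b^-1 * g _]/(b^-1 *: g _) -!linearZ/=.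
  rewrite scalerBr scalerK ?gt_eqF//.
  apply: sup_upper_bound; first exact: has_sup_dual_join.
  have bi0 : 0 <= b^-1 by rewrite invr_ge0 ltW.
  exists (b^-1 *: z) => //=; rewrite bler_scale//=.
  have := bler_scale bi0 (_ : 0 <= b *: y - z); rewrite bsubr_ge0 => /(_ zy).
  by rewrite scalerBr scalerK ?gt_eqF// bsubr_ge0.
rewrite le_eqVlt => /predU1P[<-|a0] x0.
  rewrite scale0r mul0r; apply: (@addrI _ (sup (dual_join_set f g 0))).
  by rewrite -sup_dual_joinD// !addr0.
apply/eqP; rewrite eq_le H//= -ler_pdivlMl//.
rewrite -[in leLHS](scalerK (lt0r_neq0 a0) x) H ?invr_gt0//.
by rewrite bler_scale// ltW.
Qed.

Lemma dual_join_funE f g u v : 0 <= u -> 0 <= v ->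
  dual_join_fun f g (u - v) =
  sup (dual_join_set f g u) - sup (dual_join_set f g v).
Proof.
move=> u0 v0; apply/eqP; rewrite subr_eq addrAC eq_sym subr_eq; apply/eqP.
rewrite -!sup_dual_joinD ?bpos_ge0 ?bneg_ge0//.
congr (sup (dual_join_set f g _)).
rewrite -[bpos (u - v)](subrK (bneg (u - v))) -bposBneg.
by rewrite addrAC subrK.
Qed.

Lemma dual_join_fun_ge0 f g x : 0 <= x ->
  dual_join_fun f g x = sup (dual_join_set f g x).
Proof.
move=> x0; rewrite -[x in LHS]subr0 dual_join_funE//.
rewrite -[X in _ - sup (dual_join_set f g X)](scale0r 0).
by rewrite sup_dual_joinZ// mul0r subr0.
Qed.

Fact dual_join_linear f g : linear (dual_join_fun f g).
Proof.
have D x y : dual_join_fun f g (x + y) =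
    dual_join_fun f g x + dual_join_fun f g y.
  rewrite [x in LHS]bposBneg [y in LHS]bposBneg addrACA -opprD.
  rewrite dual_join_funE ?sup_dual_joinD ?bpos_ge0 ?bneg_ge0//; last first.
  - by rewrite -[0]addr0 blerD ?bneg_ge0.
  - by rewrite -[0]addr0 blerD ?bpos_ge0.
  by rewrite opprD addrACA.
have Z a x : dual_join_fun f g (a *: x) = a * dual_join_fun f g x.
  have [a0|/ltW a0] := leP 0 a.
    rewrite [x in LHS]bposBneg scalerBr.
    rewrite dual_join_funE ?bler_scale ?bpos_ge0 ?bneg_ge0//.
    by rewrite !sup_dual_joinZ ?bpos_ge0 ?bneg_ge0// -mulrBr.
  rewrite -oppr_ge0 in a0.
  rewrite [x in LHS]bposBneg -[a]opprK scaleNr -scalerN opprB scalerBr.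
  rewrite dual_join_funE ?bler_scale ?bpos_ge0 ?bneg_ge0//.
  by rewrite !sup_dual_joinZ ?bpos_ge0 ?bneg_ge0// -mulrBr -opprB mulrNN opprK.
by move=> a x y; rewrite D Z.
Qed.

Fact dual_join_subproof f g : dual_join_fun f g \in bounded_linear E R.
Proof.
apply: (bounded_linearP (@dual_join_linear f g)).
have H x : 0 <= x -> `|sup (dual_join_set f g x)| <= (`|f| + `|g|) * `|x|.
  move=> x0; have [ne ub] := has_sup_dual_join f g x0.
  rewrite ler_norml; apply/andP; split.
    have [c fc] := ne; apply: (@le_trans _ _ c); last exact: sup_upper_bound.
    by have := dual_join_set_le x0 fc; rewrite ler_norml => /andP[].
  apply: ge_sup => // c /(dual_join_set_le x0); exact: le_trans (ler_norm _).
exists ((`|f| + `|g|) + (`|f| + `|g|)) => x.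
rewrite (le_trans (ler_normB _ _))// mulrDl lerD//.
  rewrite (le_trans (H _ (bpos_ge0 x)))// ler_wpM2l ?norm_bpos//.
  by rewrite addr_ge0 ?bop_norm_ge0.
rewrite (le_trans (H _ (bneg_ge0 x)))// ler_wpM2l ?norm_bneg//.
by rewrite addr_ge0 ?bop_norm_ge0.
Qed.

Definition dual_join f g : dual := Bop (dual_join_subproof f g).
Definition dual_meet f g : dual := - dual_join (- f) (- g).

Fact dual_leUx f g h : dual_le (dual_join f g) h = dual_le f h && dual_le g h.
Proof.
apply/asboolP/andP => [H|[/asboolP fh /asboolP gh] x x0].
  split; apply/asboolP => x x0; apply: le_trans (H x x0);
      rewrite /= dual_join_fun_ge0//; apply: sup_upper_bound.
  - exact: has_sup_dual_join.
  - by exists x => /=; rewrite ?x0 ?lexx// subrr linear0 addr0.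
  - exact: has_sup_dual_join.
  - by exists 0 => /=; rewrite ?x0 ?lexx// subr0 linear0 add0r.
rewrite /= dual_join_fun_ge0//; apply: ge_sup.
  by have [] := has_sup_dual_join f g x0.
move=> _ [y /= /andP[y0 yx] <-].
by rewrite -[in leRHS](subrK y x) addrC [leRHS]linearD lerD ?gh ?fh ?bsubr_ge0.
Qed.

Lemma dual_leN2 f g : dual_le (- f) (- g) = dual_le g f.
Proof.
by apply/asboolP/asboolP => H x x0; have := H x x0; rewrite /= lerN2.
Qed.

Fact dual_lexI f g h : dual_le f (dual_meet g h) = dual_le f g && dual_le f h.
Proof.
by rewrite -[f]opprK dual_leN2 dual_leUx !dual_leN2 opprK.
Qed.

Fact dual_leD2r h f g : dual_le f g -> dual_le (f + h) (g + h).
Proof. by move=> /asboolP fg; apply/asboolP => x x0; rewrite lerD2r fg. Qed.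

Fact dual_scale_ge0 (a : R) f : 0 <= a -> dual_le 0 f -> dual_le 0 (a *: f).
Proof.
move=> a0 /asboolP f0; apply/asboolP => x x0.
exact: mulr_ge0 (f0 x x0).
Qed.

Fact dual_ler_norm f g :
  dual_le (dual_join f (- f)) (dual_join g (- g)) -> `|f| <= `|g|.
Proof.
move=> /asboolP fg; apply: bop_norm_le => [|x]; first exact: bop_norm_ge0.
have H y : f y <= `|g| * `|y|.
  have w0 : 0 <= bpos y + bneg y by rewrite -[0]addr0 blerD ?bpos_ge0 ?bneg_ge0.
  apply: (@le_trans _ _ (`|g| * `|bpos y + bneg y|)); last first.
    by rewrite ler_wpM2l ?bop_norm_ge0 ?norm_bposDneg.
  have := fg _ w0; rewrite /= !dual_join_fun_ge0// => fgw.
  apply: (@le_trans _ _ (sup (dual_join_set f (- f) (bpos y + bneg y)))).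
    apply: sup_upper_bound; first exact: has_sup_dual_join.
    exists (bpos y).
      rewrite /= bpos_ge0/= -{1}[bpos y]addr0 ![bpos y + _]addrC.
      by rewrite blerD2r bneg_ge0.
    by rewrite addrAC subrr add0r [in RHS](bposBneg y) linearB.
  apply: (le_trans fgw); apply: ge_sup.
    by have [] := has_sup_dual_join g (- g) w0.
  set w := bpos y + bneg y in w0 *.
  move=> _ [z /= /andP[z0 zw] <-]; rewrite -linearB/=.
  rewrite (le_trans (ler_norm _))// (le_trans (bop_normP _ _))//.
  rewrite ler_wpM2l ?bop_norm_ge0// bler_norm//.
    by rewrite opprB addrA blerBlDr blerD.
  rewrite opprB !blerBlDr -addrA -{1}[w]add0r [leRHS]addrC blerD2r.
  by rewrite -[0]addr0 blerD.
rewrite ler_norml H andbT lerNl -linearN -[`|x|]normrN; exact: H.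
Qed.

HB.instance Definition _ := isBanachLattice.Build R dual
  dual_le_refl dual_le_anti dual_le_trans dual_leUx dual_lexI
  dual_leD2r dual_scale_ge0 dual_ler_norm.

End DualLattice.


Section Ell1Lattice.
Context {R : realType}.
Implicit Types x y z : ell1 R.

Definition ell1_le x y := `[< forall n, x n <= y n >].

Fact ell1_le_refl : reflexive ell1_le.
Proof. by move=> x; apply/asboolP. Qed.

Fact ell1_le_anti : antisymmetric ell1_le.
Proof.
move=> x y /andP[/asboolP xy /asboolP yx]; apply/val_inj/funext => n /=.
by apply: le_anti; rewrite xy yx.
Qed.

Fact ell1_le_trans : transitive ell1_le.
Proof.
move=> y x z /asboolP xy /asboolP yz; apply/asboolP => n.
exact: le_trans (xy n) (yz n).
Qed.

Fact ell1_join_subproof x y : (fun n => Num.max (x n) (y n)) \in summable1.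
Proof.
apply/summable1P; exists (`|x| + `|y|) => n.
apply: le_trans (lerD (ell1_series_le x n) (ell1_series_le y n)).
rewrite !seriesEnat/= -big_split/=; apply: ler_sum => i _.
by case: (leP (x i) (y i)) => _; rewrite ?lerDl ?lerDr.
Qed.

Fact ell1_meet_subproof x y : (fun n => Num.min (x n) (y n)) \in summable1.
Proof.
apply/summable1P; exists (`|x| + `|y|) => n.
apply: le_trans (lerD (ell1_series_le x n) (ell1_series_le y n)).
rewrite !seriesEnat/= -big_split/=; apply: ler_sum => i _.
by case: (leP (x i) (y i)) => _; rewrite ?lerDl ?lerDr.
Qed.

Definition ell1_join x y : ell1 R := Ell1 (ell1_join_subproof x y).
Definition ell1_meet x y : ell1 R := Ell1 (ell1_meet_subproof x y).

Fact ell1_leUx x y z : ell1_le (ell1_join x y) z = ell1_le x z && ell1_le y z.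
Proof.
apply/asboolP/andP => [H|[/asboolP xz /asboolP yz] n];
  last by rewrite /= ge_max xz yz.
by split; apply/asboolP => n; have := H n; rewrite /= ge_max => /andP[].
Qed.

Fact ell1_lexI x y z : ell1_le x (ell1_meet y z) = ell1_le x y && ell1_le x z.
Proof.
apply/asboolP/andP => [H|[/asboolP xy /asboolP xz] n];
  last by rewrite /= le_min xy xz.
by split; apply/asboolP => n; have := H n; rewrite /= le_min => /andP[].
Qed.

Fact ell1_leD2r z x y : ell1_le x y -> ell1_le (x + z) (y + z).
Proof. by move=> /asboolP xy; apply/asboolP => n; rewrite lerD2r xy. Qed.

Fact ell1_scale_ge0 (a : R) x : 0 <= a -> ell1_le 0 x -> ell1_le 0 (a *: x).
Proof.
move=> a0 /asboolP x0; apply/asboolP => n; exact: mulr_ge0 (x0 n).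
Qed.

Fact ell1_ler_norm x y :
  ell1_le (ell1_join x (- x)) (ell1_join y (- y)) -> `|x| <= `|y|.
Proof.
move=> /asboolP xy; apply: ell1_norm_le => n.
apply: le_trans (ell1_series_le y n); rewrite !seriesEnat/=.
apply: ler_sum => i _; rewrite -(maxrN (x i)) -(maxrN (y i)); exact: (xy i).
Qed.

HB.instance Definition _ := isBanachLattice.Build R (ell1 R)
  ell1_le_refl ell1_le_anti ell1_le_trans ell1_leUx ell1_lexI
  ell1_leD2r ell1_scale_ge0 ell1_ler_norm.

End Ell1Lattice.


HB.instance Definition _ (R : realType) (E : banachLatticeType R) :=
  Order.Lattice.copy (bounded_op E R) (bounded_op E R : banachLatticeType R).
HB.instance Definition _ (R : realType) :=
  Order.Lattice.copy (ell1 R) (ell1 R : banachLatticeType R).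

Definition dual (R : realType) (E : normedModType R) := bounded_op E R.
HB.instance Definition _ (R : realType) (E : normedModType R) :=
  CompleteNormedModule.on (dual E).
HB.instance Definition _ (R : realType) (E : banachLatticeType R) :=
  BanachLattice.on (dual E).
HB.instance Definition _ (R : realType) (E : banachLatticeType R) :=
  Order.Lattice.on (dual E).

Section Operators.
Context {R : realType}.

Fact op_comp_subproof (U V W : normedModType R)
    (S : bounded_op V W) (T : bounded_op U V) :
  S \o T \in bounded_linear U W.
Proof.
apply/asboolP; split=> [a x y|x]; first by rewrite /= !linearP.
by apply: continuous_comp; exact: bop_continuous.
Qed.
Definition op_comp (U V W : normedModType R)
    (S : bounded_op V W) (T : bounded_op U V) : bounded_op U W :=
  Bop (op_comp_subproof S T).

Fact adjoint_subproof (V W : normedModType R) (T : bounded_op V W) :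
  (fun g : dual W => op_comp g T : dual V) \in bounded_linear (dual W) (dual V).
Proof.
apply: bounded_linearP => [a f g|]; first by apply/val_inj/funext.
exists (bop_norm T) => g; apply: bop_norm_le => [|x].
  by rewrite mulr_ge0 ?bop_norm_ge0.
rewrite (le_trans (bop_normP g _))// mulrAC [leRHS]mulrC.
by rewrite ler_wpM2l ?bop_norm_ge0 ?bop_normP.
Qed.
Definition adjoint (V W : normedModType R) (T : bounded_op V W) :
  bounded_op (dual W) (dual V) := Bop (adjoint_subproof T).

Definition disjoint_seq (E : banachLatticeType R) (x : nat -> E) :=
  forall n m, n != m -> (blatt_abs (x n) `&` blatt_abs (x m))%O = 0.

Definition positive_seq (E : banachLatticeType R) (x : nat -> E) :=
  forall n, 0 <= x n.

Definition weakly_p_summable (p : R) (Z : normedModType R) (x : nat -> Z) :=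
  forall f : dual Z, cvgn (series (fun n => `|f (x n)| `^ p)).

Definition positive_op (E F : banachLatticeType R) (T : bounded_op E F) :=
  forall x, 0 <= x -> 0 <= T x.

Definition riesz_homomorphism (E F : banachLatticeType R)
    (T : bounded_op E F) :=
  {morph T : x y / (x `|` y)%O}.

Definition disjoint_p_convergent (p : R) (E : banachLatticeType R)
    (Z : completeNormedModType R) (T : bounded_op E Z) :=
  forall x : nat -> E, disjoint_seq x -> weakly_p_summable p x ->
    T (x n) @[n --> \oo] --> (0 : Z).

End Operators.

(* Main.v *)
Require Import Defs.
From mathcomp Require Import all_boot all_order all_algebra.
From mathcomp Require Import all_classical all_reals topology normedtype.
From mathcomp Require Import sequences exp.
From mathcomp Require Import lra.
Import Order.TTheory GRing.Theory Num.Theory numFieldNormedType.Exports.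
Local Open Scope classical_set_scope.
Local Open Scope ring_scope.

(** The adjoint of T being disjoint p-convergent is the strongest of the
    conditions: the pairing conditions follow from |y (T x)| <= |T^* y| |x|, and
    convergence of the compositions with S^* from continuity of S^*.  What has
    to be proved is that the two weakest conditions bring it back.

    From l_1 to positive pairings.  A bounded disjoint sequence of positive
    vectors x n in E is the image of the unit vectors under the operator S from
    l_1 to E with S a = sum a_n x_n, which preserves lattice operations because
    the x n are disjoint [ell1_riesz_homomorphism].  Norm convergence of
    S^* (T^* (y n)) then bounds the pairings y n (T (x n))
    [positive_pairing_ell1].

    From positive pairings to the adjoint.  This rests on two facts.

    First, if (y n) is disjoint and weakly p-summable, so are its positive
    parts, hence also its negative parts [weakly_p_summable_bpos].  For a
    positive functional phi, consider its part psi carried by the disjoint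
    complement of all the negative parts; it is given by a Riesz-Kantorovich
    type supremum [disjoint_complement_functional].  Then psi (y n) is phi of
    the positive part of y n for all n, and summability of the former gives
    that of the latter.  So the y n may be assumed positive.

    Second, let g n = T^* (y n); these functionals are positive and tend to 0
    pointwise.  If their norms do not tend to 0, there are positive x n in the
    unit ball with g n (x n) > e infinitely often.  Passing to a sparse
    subsequence and replacing x n by the positive part of
    x n - 4 ^ n (x 0 + ... + x (n - 1)) - 2 ^- n x, where x is the sum of the
    2 ^- n x n, makes these vectors disjoint while keeping the pairings above
    e / 2 [disjointification], contrary to the assumption on pairings. *)

(** * Vector lattice identities *)

Section RieszIdentities.
Context {R : realType} {E : banachLatticeType R}.
Implicit Types u v w x y z : E.

Lemma bler_wpDl x y : 0 <= x -> y <= x + y.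
Proof. by move=> x0; rewrite -{1}[y]add0r blerD2r. Qed.

Lemma bler_wpBr x y : 0 <= y -> x - y <= x.
Proof. by move=> y0; rewrite blerBlDr addrC bler_wpDl. Qed.

Lemma baddr_ge0 x y : 0 <= x -> 0 <= y -> 0 <= x + y.
Proof. by move=> x0 y0; rewrite -[0]addr0 blerD. Qed.

Lemma bler_wpZ2l (a : R) x y : 0 <= a -> x <= y -> a *: x <= a *: y.
Proof. by move=> a0 xy; rewrite -bsubr_ge0 -scalerBr bler_scale ?bsubr_ge0. Qed.

Lemma bler_wpZ2r (a b : R) x : a <= b -> 0 <= x -> a *: x <= b *: x.
Proof. by move=> ab x0; rewrite -bsubr_ge0 -scalerBl bler_scale ?subr_ge0. Qed.

Lemma bsumr_ge0 (I : Type) (r : seq I) (P : pred I) (f : I -> E) :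
  (forall i, P i -> 0 <= f i) -> 0 <= \sum_(i <- r | P i) f i.
Proof. by move=> f0; elim/big_ind: _ => //; exact: baddr_ge0. Qed.

Lemma ge0_bler_norm x y : 0 <= x -> x <= y -> `|x| <= `|y|.
Proof.
move=> x0 xy; rewrite bler_norm// (le_trans _ (le_trans x0 xy))//.
by rewrite -[0]oppr0 blerN2.
Qed.

Lemma blatt_abs_id x : 0 <= x -> blatt_abs x = x.
Proof.
move=> x0; apply/join_idPl; rewrite (le_trans _ x0)//.
by rewrite -[0]oppr0 blerN2.
Qed.

Lemma blatt_absN x : blatt_abs (- x) = blatt_abs x.
Proof. by rewrite /blatt_abs opprK joinC. Qed.

Lemma norm_blatt_abs x : `|blatt_abs x| = `|x|.
Proof.
apply/eqP; rewrite eq_le !blatt_abs_le_norm//;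
  by rewrite (blatt_abs_id _ (blatt_abs_ge0 x)).
Qed.

Lemma bpos_le_abs x : bpos x <= blatt_abs x.
Proof. by rewrite leUx leUl blatt_abs_ge0. Qed.

Lemma bneg_le_abs x : bneg x <= blatt_abs x.
Proof. by rewrite leUx leUr blatt_abs_ge0. Qed.

Lemma le_bpos x y : x <= y -> bpos x <= bpos y.
Proof. by move=> xy; rewrite leUx (le_trans xy (leUl _ _)) leUr. Qed.

Lemma bjoinDmeet x y : (x `|` y)%O + (x `&` y)%O = x + y.
Proof.
apply/le_anti/andP; split.
  rewrite -blerBrDr leUx !blerBrDr blerD ?leIr//=.
  by rewrite addrC blerD ?leIl.
rewrite [leRHS]addrC -blerBlDr lexI !blerBlDr andbC [leRHS]addrC blerD ?leUl//=.
by rewrite blerD ?leUr.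
Qed.

Lemma bpos_bneg_disjoint x : (bpos x `&` bneg x)%O = 0.
Proof.
set m := (bpos x `&` bneg x)%O.
have m0 : 0 <= m by rewrite lexI bpos_ge0 bneg_ge0.
apply/le_anti; rewrite m0 andbT.
suff : bpos x <= bpos x - m by rewrite blerBrDr addrC -blerBrDr subrr.
rewrite leUx bsubr_ge0 leIl andbT blerBrDr addrC -blerBrDr.
by rewrite (le_trans (leIr _ _))// {3}(bposBneg x) opprB addrC subrK.
Qed.

(** Disjoint positive vectors satisfy u + v = u `|` v, so the join of u - v and
    0, shifted by v, is u + v. *)
Lemma bpos_disjointB {u v} : 0 <= u -> 0 <= v -> (u `&` v)%O = 0 ->
  bpos (u - v) = u.
Proof.
move=> u0 v0 uv0; apply/le_anti; rewrite leUx u0 bler_wpBr//=.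
rewrite -(blerD2r v) -bjoinDmeet uv0 addr0 leUx -blerBlDr leUl/=.
by rewrite bler_wpDl// bpos_ge0.
Qed.

Lemma bjoin_bpos x y : (x `|` y)%O = y + bpos (x - y).
Proof.
apply/le_anti/andP; split.
  by rewrite leUx addrC -blerBlDr leUl/= bler_wpDl// bpos_ge0.
by rewrite addrC -blerBrDr leUx blerD2r leUl/= bsubr_ge0 leUr.
Qed.

Lemma disjointS {u v u' v'} : 0 <= u -> u <= u' -> 0 <= v -> v <= v' ->
  (u' `&` v')%O = 0 -> (u `&` v)%O = 0.
Proof.
move=> u0 uu' v0 vv' uv'; apply/le_anti.
by rewrite lexI u0 v0 andbT -uv' leI2.
Qed.

(** Riesz decomposition splits the meet into a part below u and a part below v,
    both still below w. *)
Lemma disjointD {u v w} : 0 <= u -> 0 <= v -> 0 <= w ->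
  (u `&` w)%O = 0 -> (v `&` w)%O = 0 -> ((u + v) `&` w)%O = 0.
Proof.
move=> u0 v0 w0 uw vw; set z := (_ `&` _)%O.
have z0 : 0 <= z by rewrite lexI baddr_ge0.
have [a [b [zE /andP[a0 au] /andP[b0 bv]]]] :=
  riesz_decomposition u0 v0 z0 (leIl _ _).
have zw : z <= w by exact: leIr.
suff [a_eq0 b_eq0] : a = 0 /\ b = 0 by rewrite zE a_eq0 b_eq0 addr0.
split; apply/le_anti.
  rewrite a0 andbT -uw lexI au (le_trans _ zw)//.
  by rewrite zE addrC bler_wpDl.
by rewrite b0 andbT -vw lexI bv (le_trans _ zw)// zE bler_wpDl.
Qed.

Lemma disjointZ {u w} (a : R) : 0 <= a -> 0 <= u -> 0 <= w ->
  (u `&` w)%O = 0 -> ((a *: u) `&` w)%O = 0.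
Proof.
move=> a0 u0 w0 uw.
have [n an] : exists n : nat, a <= n%:R.
  by exists (Num.trunc a).+1; exact: ltW (truncnS_gt _).
apply: (@disjointS _ _ (n%:R *: u) w) => //.
- exact: bler_scale.
- exact: bler_wpZ2r.
elim: n {an} => [|n IH]; first by rewrite scale0r; apply/meet_idPl.
by rewrite -natr1 scalerDl scale1r disjointD// bler_scale.
Qed.

Lemma disjoint_sum (I : Type) (r : seq I) (P : pred I) (f : I -> E) w :
  0 <= w -> (forall i, P i -> 0 <= f i) ->
  (forall i, P i -> (f i `&` w)%O = 0) ->
  ((\sum_(i <- r | P i) f i) `&` w)%O = 0.
Proof.
move=> w0 f0 fw.
suff [] : 0 <= \sum_(i <- r | P i) f i /\
    ((\sum_(i <- r | P i) f i) `&` w)%O = 0 by [].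
elim/big_rec: _ => [|i x Pi [x0 xw]]; first by split=> //; apply/meet_idPl.
by split; [rewrite baddr_ge0 ?f0|rewrite disjointD ?f0 ?fw].
Qed.

End RieszIdentities.

(** * Topology of the positive cone *)

Section ConeTopology.
Context {R : realType} {E : banachLatticeType R}.
Implicit Types (x y l : E) (u : nat -> E).

Lemma bpos_lipschitz x y : `|bpos x - bpos y| <= `|x - y|.
Proof.
rewrite -norm_blatt_abs -[leRHS]norm_blatt_abs.
have H a b : bpos a - bpos b <= blatt_abs (a - b).
  rewrite blerBlDr leUx -blerBlDr (le_trans _ (leUl (a - b) _))/=.
    by rewrite baddr_ge0 ?blatt_abs_ge0 ?bpos_ge0.
  by rewrite -[_ - b]opprB -[a - _]opprB blerN2 blerD2r leUl.
apply: ge0_bler_norm; first exact: blatt_abs_ge0.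
by rewrite leUx H opprB -blatt_absN opprB H.
Qed.

Lemma cvg_bpos u l : u n @[n --> \oo] --> l ->
  bpos (u n) @[n --> \oo] --> bpos l.
Proof.
move=> /cvgrPdist_lt ul; apply/cvgrPdist_lt => e e0.
apply: filterS (ul e e0) => n; exact: le_lt_trans (bpos_lipschitz _ _).
Qed.

(** The cone is closed because it is the fixed-point set of the continuous map
    taking x to its positive part. *)
Lemma cvg_bge0 u l : u n @[n --> \oo] --> l ->
  (\forall n \near \oo, 0 <= u n) -> 0 <= l.
Proof.
move=> ul u0; rewrite -(_ : bpos l = l) ?bpos_ge0//.
apply/esym/(norm_cvg_unique ul); apply: cvg_trans (cvg_bpos _ _ ul).
apply: near_eq_cvg; apply: filterS u0 => n u0; exact/join_idPl.
Qed.

Lemma cvg_series_le_bge0 u l n : series u @ \oo --> l ->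
  (forall i, 0 <= u i) -> u n <= l.
Proof.
move=> ul u0; rewrite -bsubr_ge0.
apply: (@cvg_bge0 (fun m => series u m - u n)).
  by apply: cvgB => //; exact: cvg_cst.
near=> m; rewrite bsubr_ge0 seriesEnat/= (bigD1_seq n) ?iota_uniq//=.
  by rewrite addrC bler_wpDl// bsumr_ge0.
by rewrite mem_index_iota; near: m; exact: nbhs_infty_gt.
Unshelve. all: by end_near. Qed.

End ConeTopology.

(** * Positive functionals *)

Section DualOrder.
Context {R : realType} {E : banachLatticeType R}.
Implicit Types (f g : dual E) (x y z : E).

Lemma dual_leP f g : reflect (forall x, 0 <= x -> f x <= g x) (f <= g).
Proof. exact: asboolP. Qed.

Lemma dual_ge0P f : reflect (forall x, 0 <= x -> 0 <= f x) (0 <= f).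
Proof. by apply: (iffP (dual_leP 0 f)) => H x; exact: H. Qed.

Lemma dual_ge0_le f x y : 0 <= f -> x <= y -> f x <= f y.
Proof.
by move=> /dual_ge0P f0 xy; rewrite -subr_ge0 -linearB f0 ?bsubr_ge0.
Qed.

Lemma dual_le_abs f x : 0 <= x -> `|f x| <= blatt_abs f x.
Proof.
move=> x0; have /dual_leP/(_ x x0) := leUl f (- f).
have /dual_leP/(_ x x0) := leUr (- f) f.
by rewrite [(- f) x]/(- f x) ler_norml lerNl => -> ->.
Qed.

(** Additivity makes a u - a v depend only on u - v, so the decomposition into
    positive and negative parts extends a linearly. *)
Lemma dual_extension (a : E -> R) (C : R) :
  0 <= C ->
  (forall x y, 0 <= x -> 0 <= y -> a (x + y) = a x + a y) ->
  (forall (c : R) x, 0 <= c -> 0 <= x -> a (c *: x) = c * a x) ->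
  (forall x, 0 <= x -> `|a x| <= C * `|x|) ->
  exists f : dual E, forall x, 0 <= x -> f x = a x.
Proof.
move=> C0 aD aZ aC; pose h x := a (bpos x) - a (bneg x).
have hE (u v : E) : 0 <= u -> 0 <= v -> h (u - v) = a u - a v.
  move=> u0 v0; apply/eqP; rewrite subr_eq addrAC eq_sym subr_eq; apply/eqP.
  rewrite -!aD ?bpos_ge0 ?bneg_ge0//; congr a.
  by rewrite -[bpos (u - v)](subrK (bneg (u - v))) -bposBneg addrAC subrK.
have hD x y : h (x + y) = h x + h y.
  rewrite {1}(bposBneg x) {1}(bposBneg y) addrACA -opprD.
  rewrite hE ?baddr_ge0 ?bpos_ge0 ?bneg_ge0// !aD ?bpos_ge0 ?bneg_ge0//.
  by rewrite opprD addrACA.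
have hZ c x : h (c *: x) = c * h x.
  have [c0|/ltW c0] := leP 0 c.
    rewrite {1}(bposBneg x) scalerBr hE ?bler_scale ?bpos_ge0 ?bneg_ge0//.
    by rewrite !aZ ?bpos_ge0 ?bneg_ge0// -mulrBr.
  rewrite -oppr_ge0 in c0.
  rewrite {1}(bposBneg x) -[c]opprK scaleNr -scalerN opprB scalerBr.
  rewrite hE ?bler_scale ?bpos_ge0 ?bneg_ge0//.
  by rewrite !aZ ?bpos_ge0 ?bneg_ge0// -mulrBr -opprB mulrNN opprK.
have hl : linear (h : E -> R) by move=> c x y; rewrite hD hZ.
have hb : exists M, forall x, `|h x| <= M * `|x|.
  exists (C + C) => x; rewrite mulrDl (le_trans (ler_normB _ _))// lerD//.
    by rewrite (le_trans (aC _ (bpos_ge0 x)))// ler_wpM2l ?norm_bpos.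
  by rewrite (le_trans (aC _ (bneg_ge0 x)))// ler_wpM2l ?norm_bneg.
exists (Bop (bounded_linearP hl hb)) => x x0.
have a0 : a 0 = 0 by rewrite -[X in a X](scale0r 0) aZ ?mul0r.
by rewrite -[LHS]/(h x) -{1}[x]subr0 hE// a0 subr0.
Qed.

(** The functional obtained is the part of phi carried by the disjoint
    complement of N: at x >= 0 it is the supremum of phi over the vectors
    between 0 and x that are disjoint from N.  Since these vectors form a solid
    set closed under sums, Riesz decomposition makes the supremum additive. *)
Lemma disjoint_complement_functional (phi : dual E) (N : set E) :
  0 <= phi -> (forall w, N w -> 0 <= w) ->
  exists f : dual E,
    (forall x, 0 <= x -> (forall w, N w -> (x `&` w)%O = 0) -> f x = phi x) /\
    (forall w, N w -> f w = 0).
Proof.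
move=> phi0 N0; pose D z := forall w, N w -> (z `&` w)%O = 0.
have DS (u v : E) : 0 <= u -> u <= v -> D v -> D u.
  move=> u0 uv Dv w Nw.
  exact: disjointS u0 uv (N0 w Nw) (lexx w) (Dv w Nw).
have DD (u v : E) : 0 <= u -> 0 <= v -> D u -> D v -> D (u + v).
  by move=> u0 v0 Du Dv w Nw; exact: disjointD (N0 w Nw) (Du w Nw) (Dv w Nw).
have D0 : D 0 by move=> w Nw; apply/meet_idPl/N0.
pose A (x : E) := [set phi z | z in [set z | [/\ 0 <= z, z <= x & D z]]].
have Aub (x : E) : ubound (A x) (phi x).
  by move=> _ [z [z0 zx _] <-]; exact: dual_ge0_le.
have A0 (x : E) : 0 <= x -> A x 0 by move=> x0; exists 0; rewrite ?linear0.
have Asup (x : E) : 0 <= x -> has_sup (A x).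
  by move=> x0; split; [exists 0; exact: A0|exists (phi x)].
pose a x := sup (A x).
have aD (x y : E) : 0 <= x -> 0 <= y -> a (x + y) = a x + a y.
  move=> x0 y0; rewrite /a -sup_sumE; try exact: Asup.
  congr sup; apply/seteqP; split => [_ [z [z0 zxy Dz] <-]|].
    have [u [v [zE /andP[u0 ux] /andP[v0 vy]]]] :=
      riesz_decomposition x0 y0 z0 zxy.
    exists (phi u).
      exists u => //; split=> //; apply: DS u0 _ Dz.
      by rewrite zE addrC bler_wpDl.
    exists (phi v); last by rewrite zE linearD.
    by exists v => //; split=> //; apply: DS v0 _ Dz; rewrite zE bler_wpDl.
  move=> _ [_ [u [u0 ux Du] <-] [_ [v [v0 vy Dv] <-] <-]].
  exists (u + v); rewrite ?linearD//.
  by split; [exact: baddr_ge0|exact: blerD|exact: DD].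
have aZle (c : R) (x : E) : 0 < c -> 0 <= x -> a (c *: x) <= c * a x.
  move=> c0 x0; apply: ge_sup.
    by exists 0; apply/A0/bler_scale => //; exact: ltW.
  move=> _ [z [z0 zx Dz] <-].
  have ci0 : 0 <= c^-1 by rewrite invr_ge0 ltW.
  rewrite -[z](scalerKV (lt0r_neq0 c0)) linearZ/= ler_pM2l//.
  apply: sup_upper_bound; first exact: Asup.
  exists (c^-1 *: z) => //; split; first exact: bler_scale.
    by rewrite -[x](scalerK (lt0r_neq0 c0)) bler_wpZ2l.
  by move=> w Nw; exact: disjointZ ci0 z0 (N0 w Nw) (Dz w Nw).
have aZ (c : R) (x : E) : 0 <= c -> 0 <= x -> a (c *: x) = c * a x.
  rewrite le_eqVlt => /predU1P[<-|c0] x0.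
    by rewrite scale0r mul0r; apply: (@addrI _ (a 0)); rewrite -aD// !addr0.
  apply/eqP; rewrite eq_le aZle//= -ler_pdivlMl//.
  rewrite -[in leLHS](scalerK (lt0r_neq0 c0) x) aZle ?invr_gt0//.
  by rewrite bler_scale// ltW.
have a_ge0 (x : E) : 0 <= x -> 0 <= a x.
  by move=> x0; apply: sup_upper_bound; [exact: Asup|exact: A0].
have a_le (x : E) : 0 <= x -> a x <= phi x.
  by move=> x0; apply: ge_sup => //; exists 0; exact: A0.
have [f fE] : exists f : dual E, forall x, 0 <= x -> f x = a x.
  apply: (@dual_extension a (bop_norm phi)) => // [|x x0].
    exact: bop_norm_ge0.
  rewrite ger0_norm ?a_ge0// (le_trans (a_le _ x0))//.
  by rewrite (le_trans (ler_norm _))// bop_normP.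
exists f; split=> [x x0 Dx|w Nw].
  rewrite fE//; apply/le_anti; rewrite a_le//=.
  by apply: sup_upper_bound; [exact: Asup|exists x].
rewrite fE ?N0//; apply/le_anti; rewrite a_ge0 ?N0// andbT.
apply: ge_sup; first by exists 0; apply/A0/N0.
move=> _ [z [z0 zw Dz] <-]; rewrite (_ : z = 0) ?linear0//.
by rewrite -(Dz w Nw); apply/esym/meet_idPl.
Qed.

End DualOrder.

(** * Weakly p-summable sequences *)

Section WeaklySummable.
Context {R : realType}.

(** The first n terms of the subsequence occur among the first k n terms of a,
    so the partial sums stay bounded. *)
Lemma cvg_series_subseq (a : nat -> R) (k : nat -> nat) :
  (forall n, 0 <= a n) -> (forall n, (k n < k n.+1)%N) ->
  cvgn (series a) -> cvgn (series (a \o k)).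
Proof.
move=> a0 kS /cvg_seq_bounded/bounded_fun_has_ubound[M aM].
apply: nondecreasing_is_cvgn.
  by apply: nondecreasing_series => n _ _; exact: a0.
exists M => _ [n _ <-].
have nd : nondecreasing_seq (series a) by exact: nondecreasing_series.
apply: (@le_trans _ _ (series a (k n))); last by apply: aM; exists (k n).
elim: n => [|n IH]; first by rewrite !seriesEnat/= big_geq// sumr_ge0.
apply: le_trans (nd _ _ (kS n)); move: IH.
by rewrite !seriesEnat/= !big_nat_recr//= lerD2r.
Qed.

Lemma weakly_p_summable_subseq (p : R) (Z : normedModType R) (y : nat -> Z) k :
  (forall n, (k n < k n.+1)%N) ->
  weakly_p_summable p y -> weakly_p_summable p (y \o k).
Proof.
move=> kS yp f.
have := cvg_series_subseq (fun n => `|f (y n)| `^ p) k _ kS (yp f).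
by apply=> n; exact: powR_ge0.
Qed.

Lemma weakly_p_summableN (p : R) (Z : normedModType R) (y : nat -> Z) :
  weakly_p_summable p y -> weakly_p_summable p (fun n => - y n).
Proof. by move=> yp f; under eq_fun do rewrite linearN normrN; exact: yp. Qed.

Lemma weakly_p_summable_cvg0 (p : R) (Z : normedModType R) (y : nat -> Z)
    (f : dual Z) :
  0 < p -> weakly_p_summable p y -> f (y n) @[n --> \oo] --> (0 : R).
Proof.
move=> p0 /(_ f)/cvg_series_cvg_0/cvgrPdist_lt yp.
apply/cvgrPdist_lt => e e0; apply: filterS (yp _ (powR_gt0 p e0)) => n.
rewrite !sub0r !normrN ger0_norm ?powR_ge0//; apply: contraTT; rewrite -!leNgt.
by move=> ef; apply: ge0_ler_powR => //; rewrite ?nnegrE // ltW.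
Qed.

Fact dual_eval_subproof (V : normedModType R) (v : V) :
  (fun g : dual V => g v) \in bounded_linear (dual V) R.
Proof.
apply: bounded_linearP; first by move=> a f g.
by exists `|v| => g; rewrite mulrC; exact: bop_normP.
Qed.

Definition dual_eval (V : normedModType R) (v : V) : dual (dual V) :=
  Bop (dual_eval_subproof V v).

Lemma weakly_p_summable_eval_cvg0 (p : R) (V : normedModType R)
    (y : nat -> dual V) (v : V) :
  0 < p -> weakly_p_summable p y -> y n v @[n --> \oo] --> (0 : R).
Proof. by move=> p0; exact: (weakly_p_summable_cvg0 p _ y (dual_eval V v)). Qed.

Variable E : banachLatticeType R.
Implicit Types y : nat -> E.

Lemma disjoint_seq_subseq y k : (forall n, (k n < k n.+1)%N) ->
  disjoint_seq y -> disjoint_seq (y \o k).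
Proof.
move=> kS yd n m nm; apply: yd; apply: contra nm => /eqP knm.
by apply/eqP; exact: incn_inj ((increasing_seqP k).1 kS) _ _ knm.
Qed.

Lemma disjoint_seqN y : disjoint_seq y -> disjoint_seq (fun n => - y n).
Proof. by move=> yd n m nm; rewrite !blatt_absN yd. Qed.

Lemma disjoint_bpos y : disjoint_seq y -> disjoint_seq (fun n => bpos (y n)).
Proof.
move=> yd n m nm; rewrite !blatt_abs_id ?bpos_ge0//.
apply: disjointS (yd n m nm); rewrite ?bpos_ge0//; exact: bpos_le_abs.
Qed.

(** Summability of f (bpos (y n)) does not follow from f alone, since f may
    take opposite values on the two parts of y n.  Let psi be the part of |f|
    carried by the disjoint complement of all the negative parts: then
    psi (y n) = |f| (bpos (y n)) for every n at once. *)
Lemma weakly_p_summable_bpos (p : R) y : 0 <= p -> disjoint_seq y ->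
  weakly_p_summable p y -> weakly_p_summable p (fun n => bpos (y n)).
Proof.
move=> p0 yd yp f; set phi : dual E := blatt_abs f.
have [|w [n _ <-]|psi [psi_pos psi_neg]] :=
  disjoint_complement_functional phi (range (fun n => bneg (y n))).
- exact: blatt_abs_ge0.
- exact: bneg_ge0.
have psiE n : psi (y n) = phi (bpos (y n)).
  rewrite {1}(bposBneg (y n)) linearB/= (psi_neg (bneg (y n))) ?subr0;
    last by exists n.
  apply: psi_pos; first exact: bpos_ge0.
  move=> _ [m _ <-]; have [->|nm] := eqVneq n m.
    exact: bpos_bneg_disjoint.
  apply: disjointS (yd n m nm);
    rewrite ?bpos_ge0 ?bneg_ge0 ?bpos_le_abs ?bneg_le_abs//.
apply: series_le_cvg (yp psi) => n; rewrite ?powR_ge0//.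
rewrite ge0_ler_powR ?nnegrE// psiE.
exact: le_trans (dual_le_abs f _ (bpos_ge0 (y n))) (ler_norm _).
Qed.

End WeaklySummable.

(** * Extracting disjoint vectors *)

Section Disjointification.
Context {R : realType} {E : banachLatticeType R}.
Implicit Types (g : nat -> dual E) (x : E) (X : nat -> E).

Lemma le_series X i j : (forall n, 0 <= X n) -> (i < j)%N -> X i <= series X j.
Proof.
move=> X0 ij; rewrite seriesEnat/= (bigD1_seq i) ?iota_uniq ?mem_index_iota//=.
by rewrite addrC bler_wpDl// bsumr_ge0.
Qed.

Let half_ge0 n : 0 <= (2^-1 : R) ^+ n.
Proof. by rewrite exprn_ge0// invr_ge0 ler0n. Qed.

Lemma cvg_series_half (V : completeNormedModType R) (x : nat -> V) :
  (forall n, `|x n| <= 1) -> cvgn (series (fun n => (2^-1 : R) ^+ n *: x n)).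
Proof.
move=> x1; apply: normed_cvg.
apply: (@series_le_cvg _ _ (geometric 1 2^-1)) => [n|n|n|].
- exact: normr_ge0.
- by rewrite /= mul1r.
- by rewrite /= mul1r normrZ ger0_norm// ler_piMr.
- apply: is_cvg_geometric_series.
  by rewrite ger0_norm ?invr_ge0 ?ler0n// invf_lt1 ?ltr1n ?ltr0n.
Qed.

(** Removing from X i a large multiple of the sum of its predecessors, and a
    small multiple of a vector x that controls its successors, leaves disjoint
    remainders: for i < j, the remainder at j is below the positive part of
    X j - 4 ^ j X i, and the one at i is below the negative part, because
    2 ^- i x >= 2 ^- (i + j) X j >= 4 ^- j X j. *)
Lemma disjoint_remainders X x : (forall n, 0 <= X n) ->
  (forall n, (2^-1 : R) ^+ n *: X n <= x) ->
  disjoint_seq (fun i =>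
    bpos (X i - (4 : R) ^+ i *: series X i - (2^-1 : R) ^+ i *: x)).
Proof.
move=> X0 Xx.
pose w i := X i - (4 : R) ^+ i *: series X i - (2^-1 : R) ^+ i *: x.
change (disjoint_seq (fun i => bpos (w i))).
have q0 i : 0 <= (4 : R) ^+ i by rewrite exprn_ge0// ler0n.
have sX0 i : 0 <= series X i by rewrite seriesEnat/=; exact: bsumr_ge0.
have x0 : 0 <= x by rewrite (le_trans _ (Xx 0%N))// bler_scale.
have H i j : (i < j)%N -> (bpos (w i) `&` bpos (w j))%O = 0.
  move=> ij; pose W := X j - (4 : R) ^+ j *: X i; rewrite meetC.
  apply: disjointS (bpos_bneg_disjoint W); rewrite ?bpos_ge0//.
    apply: le_bpos; rewrite /w (le_trans (bler_wpBr _ _ _)) ?bler_scale//.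
    by rewrite addrC [leRHS]addrC blerD2r blerN2 bler_wpZ2l// le_series.
  rewrite leUx bneg_ge0 andbT.
  apply: (@le_trans _ _ (((4 : R) ^+ j)^-1 *: - W)).
    rewrite opprB scalerBr scalerK ?expf_neq0 ?pnatr_eq0// /w.
    rewrite blerD//; first by rewrite bler_wpBr// bler_scale.
    rewrite blerN2; apply: le_trans (bler_wpZ2l _ _ _ (half_ge0 i) (Xx j)).
    rewrite scalerA bler_wpZ2r// -exprVn -exprD -(_ : 2^-1 ^+ 2 = 4^-1 :> R).
      rewrite -exprM ler_wiXn2l ?invr_ge0 ?ler0n ?invf_le1 ?ler1n ?ltr0n//.
      by rewrite mul2n -addnn leq_add2r ltnW.
    by rewrite exprVn -natrX.
  apply: (@le_trans _ _ (((4 : R) ^+ j)^-1 *: bneg W)).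
    by rewrite bler_wpZ2l ?invr_ge0 ?q0// leUl.
  rewrite -[leRHS]scale1r bler_wpZ2r ?bneg_ge0// invf_le1 ?exprn_gt0 ?ltr0n//.
  by rewrite exprn_ege1// ler1n.
move=> n m nm; rewrite !blatt_abs_id ?bpos_ge0//.
by move: nm; case: ltngtP => // nm _; [|rewrite meetC]; exact: H.
Qed.

(** Vectors X i on which functionals g (k i) stay above e are chosen one after
    the other.  Pointwise convergence of g to 0 allows the index k i to be taken
    so late that g (k i) is at most e / 4 on 4 ^ i times the sum of the earlier
    vectors; it also makes g (k i) eventually at most e / 4 on the sum x of the
    2 ^- i X i.  So the disjoint remainders of the X i keep a value e / 2. *)
Lemma disjointification g (e : R) : 0 < e -> (forall n, 0 <= g n) ->
  (forall x, g n x @[n --> \oo] --> (0 : R)) ->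
  (forall N, exists n x, [/\ (N <= n)%N, 0 <= x, `|x| <= 1 & e < g n x]) ->
  exists (k : nat -> nat) (u : nat -> E),
    [/\ forall n, (k n < k n.+1)%N, forall n, 0 <= u n, forall n, `|u n| <= 1,
        disjoint_seq u & \forall n \near \oo, e / 2 <= g (k n) (u n)].
Proof.
move=> e0 g0 gc hump; have e40 : 0 < e / 4 by rewrite divr_gt0.
have step (a : nat * (nat * E)) : exists b : nat * E,
    [/\ (a.2.1 <= b.1)%N, 0 <= b.2, `|b.2| <= 1, e < g b.1 b.2 &
        g b.1 ((4 : R) ^+ a.1 *: a.2.2) <= e / 4].
  have /cvgrPdist_le/(_ _ e40)[M _ gM] := gc ((4 : R) ^+ a.1 *: a.2.2).
  have [n [x [nM x0 x1 gx]]] := hump (maxn a.2.1 M).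
  move: nM; rewrite geq_max => /andP[an Mn]; exists (n, x); split => //=.
  by have := gM n Mn; rewrite sub0r normrN; exact: le_trans (ler_norm _).
have [next nextP] := choice step.
(* The state before stage i: a lower bound for the next index, and the sum of
   the vectors chosen so far. *)
pose st := fix st i := if i is j.+1 then
  let b := next (j, st j) in (b.1.+1, (st j).2 + b.2) else (0%N, 0 : E).
pose k i := (next (i, st i)).1; pose X i := (next (i, st i)).2.
have stE i : (st i).2 = series X i.
  rewrite seriesEnat/=; elim: i => [|i IH]; first by rewrite big_geq.
  by rewrite big_nat_recr//= -IH.
have X0 i : 0 <= X i by have [] := nextP (i, st i).
have X1 i : `|X i| <= 1 by have [] := nextP (i, st i).
have gX i : e < g (k i) (X i) by have [] := nextP (i, st i).
have gs i : g (k i) ((4 : R) ^+ i *: series X i) <= e / 4.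
  by rewrite -stE; have [] := nextP (i, st i).
have kS i : (k i < k i.+1)%N by have [] := nextP (i.+1, st i.+1).
have /cvg_ex[x cx] := cvg_series_half E X X1.
have Xx n : (2^-1 : R) ^+ n *: X n <= x.
  by apply: cvg_series_le_bge0 n cx _ => i; exact: bler_scale.
have x0 : 0 <= x by rewrite (le_trans _ (Xx 0%N))// bler_scale.
pose w i := X i - (4 : R) ^+ i *: series X i - (2^-1 : R) ^+ i *: x.
exists k, (fun i => bpos (w i)); split => //.
- by move=> n; exact: bpos_ge0.
- move=> n; apply: le_trans (X1 n); rewrite ge0_bler_norm ?bpos_ge0//.
  rewrite leUx X0 andbT /w (le_trans (bler_wpBr _ _ _)) ?bler_scale//.
  by rewrite bler_wpBr// bler_scale ?exprn_ge0 ?ler0n// seriesEnat/= bsumr_ge0.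
- exact: disjoint_remainders.
have /cvgrPdist_le/(_ _ e40)[M _ gM] := gc x; exists M => // n /= Mn.
apply: le_trans (dual_ge0_le _ _ _ (g0 (k n)) (leUl (w n) 0)).
have {}gM : g (k n) ((2^-1 : R) ^+ n *: x) <= e / 4.
  have Mk : (M <= k n)%N.
    rewrite (leq_trans Mn)//; elim: (n) => // j jk.
    exact: leq_ltn_trans jk (kS j).
  have := gM _ Mk; rewrite sub0r normrN; apply: le_trans.
  rewrite (le_trans _ (ler_norm _))// linearZ/= ler_piMl//.
    by have /dual_ge0P := g0 (k n); apply.
  by rewrite exprn_ile1 ?invr_ge0 ?ler0n// invf_le1 ?ler1n ?ltr0n.
rewrite /w !linearB/= -addrA -opprD.
rewrite (_ : e / 2 = e - (e / 4 + e / 4)).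
  by rewrite lerB ?lerD ?gs ?gM// ltW.
by lra.
Qed.

End Disjointification.

(** * Operators on the sequence space *)

Section Ell1Operator.
Context {R : realType}.

Lemma exists_ell1_units : exists d : nat -> ell1 R,
  (forall n m, d n m = (m == n)%:R) /\ (forall n, `|d n| <= 1).
Proof.
have H n m : series (fun i => `|(i == n)%:R : R|) m <= 1.
  rewrite seriesEnat/=; have [nm|mn] := ltnP n m.
    rewrite (bigD1_seq n) ?iota_uniq ?mem_index_iota//= eqxx normr1.
    by rewrite big1 ?addr0// => i /negPf ->; rewrite normr0.
  rewrite big_nat big1 ?ler01// => i /andP[_ im].
  by rewrite ltn_eqF ?normr0// (leq_trans im).
have dP n : (fun m => (m == n)%:R : R) \in summable1.
  by apply/summable1P; exists 1; exact: H.
exists (fun n => Ell1 (dP n)); split => // n.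
exact: (@ell1_norm_le _ (Ell1 (dP n)) 1 (H n)).
Qed.

Lemma ell1_series_op (E : completeNormedModType R) (x : nat -> E) (M : R) :
  (forall n, `|x n| <= M) ->
  exists S : bounded_op (ell1 R) E, forall a : ell1 R,
    series (fun n => a n *: x n) @ \oo --> S a.
Proof.
move=> xM; have M0 : 0 <= M := le_trans (normr_ge0 _) (xM 0%N).
have cx (a : ell1 R) : cvgn (series (fun n => a n *: x n)).
  apply: normed_cvg.
  apply: (@series_le_cvg _ _ (fun n => M * `|a n|)) => [n|n|n|].
  - exact: normr_ge0.
  - exact: mulr_ge0.
  - by rewrite /= normrZ mulrC ler_wpM2r.
  - by apply: is_cvg_seriesZ; have /asboolP := valP a.
pose S (a : ell1 R) := limn (series (fun n => a n *: x n)).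
have Sl : linear S.
  move=> c a b; apply/norm_cvg_lim.
  rewrite (_ : series _ = (fun n => c *: series (fun n => a n *: x n) n +
      series (fun n => b n *: x n) n)).
    by apply: cvgD; [apply: cvgZr|]; exact: cx.
  apply/funext => n; rewrite !seriesEnat/= scaler_sumr -big_split/=.
  by apply: eq_bigr => i _; rewrite scalerDl scalerA.
have Sb : exists C, forall a, `|S a| <= C * `|a|.
  exists M => a.
  have cn : `|series (fun n => a n *: x n) n| @[n --> \oo] --> `|S a|.
    by apply: cvg_norm; exact: cx.
  rewrite -(norm_cvg_lim cn); apply: limr_le.
    by apply/cvg_ex; exists `|S a|.
  apply: nearW => n; rewrite seriesEnat/= (le_trans (ler_norm_sum _ _ _))//.
  apply: le_trans (ler_wpM2l M0 (ell1_series_le a n)).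
  rewrite seriesEnat/= mulr_sumr; apply: ler_sum => i _.
  by rewrite normrZ mulrC ler_wpM2r.
by exists (Bop (bounded_linearP Sl Sb)) => a; exact: cx.
Qed.

Variable E : banachLatticeType R.

(** Joins are recovered from positive parts by a `|` b = b + bpos (a - b). *)
Lemma riesz_homomorphism_bpos (G : banachLatticeType R) (S : bounded_op G E) :
  (forall a, S (bpos a) = bpos (S a)) -> riesz_homomorphism S.
Proof. by move=> Sp a b; rewrite !bjoin_bpos linearD/= Sp linearB. Qed.

(** The sums over the positive and over the negative parts of the coefficients
    are disjoint, so they are the two parts of their difference. *)
Lemma bpos_disjoint_series (x : nat -> E) (a : nat -> R) n :
  positive_seq x -> disjoint_seq x ->
  bpos (series (fun i => a i *: x i) n) =
  series (fun i => Num.max (a i) 0 *: x i) n.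
Proof.
move=> x0 xd; pose P i := Num.max (a i) 0 *: x i.
pose N i := Num.max (- a i) 0 *: x i.
have P0 i : 0 <= P i by rewrite bler_scale// le_max lexx orbT.
have N0 i : 0 <= N i by rewrite bler_scale// le_max lexx orbT.
have PN i j : (P i `&` N j)%O = 0.
  have [->|ij] := eqVneq i j.
    have [aj|/ltW aj] := leP 0 (a j).
      by rewrite /N max_r ?oppr_le0// scale0r meetC; apply/meet_idPl.
    by rewrite /P max_r// scale0r; apply/meet_idPl.
  apply: disjointZ; rewrite ?le_max ?lexx ?orbT// meetC.
  apply: disjointZ; rewrite ?le_max ?lexx ?orbT// meetC.
  by have := xd i j ij; rewrite !blatt_abs_id.
have PN_sum : series (fun i => a i *: x i) n = series P n - series N n.
  rewrite !seriesEnat/= -sumrB; apply: eq_bigr => i _; rewrite -scalerBl.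
  congr (_ *: _); have [ai|/ltW ai] := leP 0 (a i).
    by rewrite max_r ?subr0// oppr_le0.
  by rewrite max_l ?opprK ?add0r// oppr_ge0.
rewrite PN_sum bpos_disjointB// !seriesEnat/=; [exact: bsumr_ge0..|].
apply: disjoint_sum => [|//|i _]; first exact: bsumr_ge0.
by rewrite meetC; apply: disjoint_sum => // j _; rewrite meetC.
Qed.

(** A bounded disjoint sequence of positive vectors is the image of the unit
    vectors under a lattice homomorphism: disjointness makes the positive part
    of a finite sum the sum with positive parts of the coefficients, and this
    passes to the limit. *)
Lemma ell1_riesz_homomorphism (x : nat -> E) (M : R) :
  (forall n, `|x n| <= M) -> positive_seq x -> disjoint_seq x ->
  exists2 S : bounded_op (ell1 R) E, riesz_homomorphism S &
    exists d : nat -> ell1 R, (forall n, `|d n| <= 1) /\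
                              (forall n, S (d n) = x n).
Proof.
move=> xM x0 xd; have [S SP] := ell1_series_op E x M xM; exists S.
  apply: riesz_homomorphism_bpos => a.
  apply: norm_cvg_unique (cvg_bpos _ _ (SP a)).
  rewrite (_ : (fun n => _) = series (fun i => (bpos a) i *: x i)).
    exact: SP.
  by apply/funext => n; exact: bpos_disjoint_series.
have [d [dE d1]] := exists_ell1_units; exists d; split=> // n.
apply: (norm_cvg_unique (SP (d n))); apply: cvg_near_cst.
exists n.+1 => // m /= nm.
rewrite seriesEnat/= (bigD1_seq n) ?iota_uniq ?mem_index_iota//= dE eqxx.
by rewrite scale1r big1 ?addr0// => i /negPf ni; rewrite dE ni scale0r.
Qed.

End Ell1Operator.

(** * The equivalence *)

Section Operators.
Context {R : realType}.

(** A positive functional is at least as large on the modulus of a vector as on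
    the vector, so its norm is approached on positive vectors. *)
Lemma dual_ge0_norm_gt (E : banachLatticeType R) (f : dual E) (e : R) :
  0 <= f -> e < `|f| -> exists2 x : E, 0 <= x /\ `|x| <= 1 & e < f x.
Proof.
move=> f0 /sup_gt[|_ [x /= x1 <-] efx]; first by have [] := has_sup_bop f.
exists (blatt_abs x); first by rewrite blatt_abs_ge0 norm_blatt_abs.
apply: (lt_le_trans efx); rewrite ler_norml lerNl -linearN.
by rewrite !dual_ge0_le ?leUl ?leUr.
Qed.

Lemma bounded_fun_le (V : normedModType R) (x : nat -> V) (M : R) :
  (forall n, `|x n| <= M) -> bounded_fun x.
Proof.
move=> xM; exists M; split; first exact: num_real.
by move=> r /ltW Mr n _; exact: le_trans (xM n) Mr.
Qed.

Lemma bounded_funE (V : normedModType R) (x : nat -> V) :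
  bounded_fun x -> exists M, forall n, `|x n| <= M.
Proof.
by move=> [M [_ xM]]; exists (M + 1) => n; apply: xM; rewrite ?ltrDl.
Qed.

Lemma disjoint_p_convergent_comp (p : R) (E : banachLatticeType R)
    (V W : completeNormedModType R) (S : bounded_op V W) (T : bounded_op E V) :
  disjoint_p_convergent p T -> disjoint_p_convergent p (op_comp S T).
Proof.
move=> Tp y yd yp; rewrite -[X in _ --> X](linear0 S).
by apply: continuous_cvg (Tp y yd yp); exact: bop_continuous.
Qed.

Lemma adjoint_pairing_cvg0 (E F : normedModType R) (T : bounded_op E F)
    (y : nat -> dual F) (x : nat -> E) (M : R) :
  (forall n, `|x n| <= M) -> adjoint T (y n) @[n --> \oo] --> (0 : dual E) ->
  y n (T (x n)) @[n --> \oo] --> (0 : R).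
Proof.
move=> xM Ty; have M1 : 0 < `|M| + 1 by rewrite ltr_wpDl.
apply/cvgrPdist_lt => e e0; have e1 := divr_gt0 e0 M1.
have /cvgrPdist_lt/(_ _ e1) := Ty; apply: filterS => n.
rewrite !sub0r !normrN ltr_pdivlMr//; apply: le_lt_trans.
apply: le_trans (bop_normP (adjoint T (y n)) (x n)) _.
apply: ler_wpM2l; first exact: bop_norm_ge0.
by rewrite (le_trans (xM n))// (le_trans (ler_norm M))// lerDl.
Qed.

Definition positive_pairing (p : R) {E F : banachLatticeType R}
    (T : bounded_op E F) :=
  forall (y : nat -> dual F) (x : nat -> E),
    positive_seq y -> disjoint_seq y -> weakly_p_summable p y ->
    bounded_fun x -> positive_seq x -> disjoint_seq x ->
    y n (T (x n)) @[n --> \oo] --> (0 : R).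

Section PositiveOperator.
Context (p : R) (p0 : 0 < p) {E F : banachLatticeType R}.
Variables (T : bounded_op E F) (T0 : positive_op T).

(** If the norms of T^* y n do not tend to 0, positive vectors of the unit ball
    witness this along a subsequence; since y n tends to 0 pointwise, these vectors can be
    replaced by disjoint ones, contradicting the pairing condition. *)
Lemma adjoint_positive_cvg0 (y : nat -> dual F) :
  positive_pairing p T ->
  positive_seq y -> disjoint_seq y -> weakly_p_summable p y ->
  adjoint T (y n) @[n --> \oo] --> (0 : dual E).
Proof.
move=> pairing y0 yd yp; apply/cvgrPdist_le => e e0.
apply: contrapT => not_near.
have Ty0 n : 0 <= adjoint T (y n).
  by apply/dual_ge0P => x x0; have /dual_ge0P := y0 n; apply; exact: T0.
have [N|k [u [kS u0 u1 ud]]] := disjointification _ _ e0 Ty0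
    (fun x => weakly_p_summable_eval_cvg0 p F y (T x) p0 yp).
  apply: contrapT => no_hump; apply: not_near; exists N => // n /= Nn.
  rewrite sub0r normrN leNgt; apply/negP => /(dual_ge0_norm_gt _ _ _ (Ty0 n)).
  by move=> [x [x0 x1] ex]; apply: no_hump; exists n, x.
have := pairing (y \o k) u (fun n => y0 (k n)) (disjoint_seq_subseq _ _ _ kS yd)
  (weakly_p_summable_subseq _ _ _ _ kS yp) (bounded_fun_le _ _ _ u1) u0 ud.
move=> /cvgrPdist_lt/(_ _ (divr_gt0 e0 (ltr0Sn _ 1))) small large.
have [n [/= sn ln]] := filter_ex (filterI small large).
move: sn; rewrite sub0r normrN ltNge; apply/negP; rewrite negbK.
exact: le_trans ln (ler_norm _).
Qed.

(** Splitting y n into its positive and negative parts reduces the claim to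
    positive sequences, because both parts inherit weak summability. *)
Lemma adjoint_disjoint_p_convergent :
  positive_pairing p T -> disjoint_p_convergent p (adjoint T).
Proof.
move=> pairing y yd yp.
have pos z : disjoint_seq z -> weakly_p_summable p z ->
    adjoint T (bpos (z n)) @[n --> \oo] --> (0 : dual E).
  move=> zd zp; apply: adjoint_positive_cvg0 => //.
  - by move=> n; exact: bpos_ge0.
  - exact: disjoint_bpos.
  - by apply: weakly_p_summable_bpos => //; exact: ltW.
rewrite (_ : (fun n => _) = (fun n =>
    adjoint T (bpos (y n)) - adjoint T (bneg (y n)))); last first.
  by apply/funext => n; rewrite -linearB -bposBneg.
have neg : adjoint T (bneg (y n)) @[n --> \oo] --> (0 : dual E).
  by apply: (pos (fun n => - y n));
    [exact: disjoint_seqN|exact: weakly_p_summableN].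
by have := cvgB (pos y yd yp) neg; rewrite subr0; apply.
Qed.

(** With S mapping the unit vectors d n to x n, the pairing y n (T (x n)) is the
    value of S^* (T^* (y n)) at d n. *)
Lemma positive_pairing_ell1 :
  (forall S : bounded_op (ell1 R) E, riesz_homomorphism S ->
     disjoint_p_convergent p (op_comp (adjoint S) (adjoint T))) ->
  positive_pairing p T.
Proof.
move=> Sp y x y0 yd yp /bounded_funE[M xM] x0 xd.
have [S Sh [d [d1 Sd]]] := ell1_riesz_homomorphism _ _ _ xM x0 xd.
have := adjoint_pairing_cvg0 _ _ S (fun n => adjoint T (y n)) d 1 d1
  (Sp S Sh y yd yp).
by under eq_fun do rewrite /= Sd.
Qed.

End PositiveOperator.
End Operators.

Theorem theorem3p4 (R : realType) (p : R) (hp : 1 <= p)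
    (E F : banachLatticeType R) (T : bounded_op E F) (hT : positive_op T) :
  [<-> disjoint_p_convergent p (adjoint T);

       forall (y : nat -> dual F) (x : nat -> E),
         disjoint_seq y -> weakly_p_summable p y -> bounded_fun x ->
         y n (T (x n)) @[n --> \oo] --> (0 : R);

       forall (y : nat -> dual F) (x : nat -> E),
         disjoint_seq y -> weakly_p_summable p y ->
         bounded_fun x -> disjoint_seq x ->
         y n (T (x n)) @[n --> \oo] --> (0 : R);

       forall (y : nat -> dual F) (x : nat -> E),
         positive_seq y -> disjoint_seq y -> weakly_p_summable p y ->
         bounded_fun x -> disjoint_seq x ->
         y n (T (x n)) @[n --> \oo] --> (0 : R);

       forall (y : nat -> dual F) (x : nat -> E),
         positive_seq y -> disjoint_seq y -> weakly_p_summable p y ->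
         bounded_fun x -> positive_seq x -> disjoint_seq x ->
         y n (T (x n)) @[n --> \oo] --> (0 : R);

       forall (G : banachLatticeType R) (S : bounded_op G E),
         riesz_homomorphism S ->
         disjoint_p_convergent p (op_comp (adjoint S) (adjoint T));

       forall S : bounded_op (ell1 R) E,
         riesz_homomorphism S ->
         disjoint_p_convergent p (op_comp (adjoint S) (adjoint T));

       forall (G : banachLatticeType R) (S : bounded_op G E),
         positive_op S ->
         disjoint_p_convergent p (op_comp (adjoint S) (adjoint T));

       forall S : bounded_op (ell1 R) E,
         positive_op S ->
         disjoint_p_convergent p (op_comp (adjoint S) (adjoint T)) ].
Proof.
have p0 : 0 < p := lt_le_trans ltr01 hp.
have a_h : disjoint_p_convergent p (adjoint T) ->
    forall (G : banachLatticeType R) (S : bounded_op G E),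
      disjoint_p_convergent p (op_comp (adjoint S) (adjoint T)).
  by move=> Tp G S; exact: disjoint_p_convergent_comp.
have e_a := adjoint_disjoint_p_convergent p p0 T hT.
have g_a : (forall S : bounded_op (ell1 R) E, riesz_homomorphism S ->
      disjoint_p_convergent p (op_comp (adjoint S) (adjoint T))) ->
    disjoint_p_convergent p (adjoint T).
  by move=> /positive_pairing_ell1; exact: e_a.
tfae.
- move=> Tp y x yd yp /bounded_funE[M xM].
  exact: adjoint_pairing_cvg0 xM (Tp y yd yp).
- by move=> H y x yd yp xb _; exact: H.
- by move=> H y x _; exact: H.
- by move=> H y x y0 yd yp xb _; exact: H.
- by move=> /e_a/a_h H G S _; exact: H.
- by move=> H S; exact: H.
- by move=> /g_a/a_h H G S _; exact: H.
- by move=> H S; exact: H.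
- move=> H; apply: g_a => S Sh; apply: H => x x0.
  have := Sh x 0; rewrite linear0 (join_idPl x0) => ->; exact: leUr.
Qed.
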